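(* For any injective map $f \colon \mathbb{N} \to \mathbb{Z}$, the image of $\left(f\left(\frac{p-1}{k_p}\right)\right)_{p \in \mathbb{P}} \in \mathbb{Z}^{\mathbb{P}}$ in $\mathscr{A}$ is transcendental over $\mathbb{Q}$.
   Context: $\mathbb{N}$ denotes the set of non-negative integers and $\mathbb{P}$ the set of prime numbers; $\mathbb{F}_p = \mathbb{Z}/p\mathbb{Z}$. For $p \in \mathbb{P}$, $k_p$ denotes the greatest odd divisor of $p-1$, so $\frac{p-1}{k_p}$ is the greatest power of $2$ dividing $p-1$. The ring $\mathscr{A}$ of integers modulo infinitely large primes is $\mathscr{A} = \prod_{p \in \mathbb{P}} \mathbb{F}_p \big/ \bigoplus_{p \in \mathbb{P}} \mathbb{F}_p$, a commutative $\mathbb{Q}$-algebra (each nonzero integer is invertible modulo all but finitely many primes). The image in $\mathscr{A}$ of a sequence of integers $(a(p))_{p \in \mathbb{P}}$ is the class of $(a(p) \bmod p)_{p \in \mathbb{P}}$. An element $\alpha \in \mathscr{A}$ is (naively) algebraic over $\mathbb{Q}$ if there is a nonzero $g \in \mathbb{Q}[x]$ with $g(\alpha) = 0$ in $\mathscr{A}$, and (naively) transcendental over $\mathbb{Q}$ otherwise. *)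

(* Defs.v *)
From HB Require Import structures.
From mathcomp Require Import all_boot all_order all_algebra.
From mathcomp Require Import boolp classical_sets cardinality.
Set Implicit Arguments.
Unset Strict Implicit.
Unset Printing Implicit Defensive.

Import Order.TTheory GRing.Theory Num.Theory.

Local Open Scope ring_scope.
Local Open Scope quotient_scope.

Definition primeT : Type := {p : nat | prime p}.

Definition prodF : Type := forall p : primeT, 'F_(val p).

HB.instance Definition _ := gen_eqMixin prodF.
HB.instance Definition _ := gen_choiceMixin prodF.

Section ProductRing.
Implicit Types a b c : prodF.

Definition prodF_zero : prodF := fun=> 0.
Definition prodF_opp a : prodF := fun p => - a p.
Definition prodF_add a b : prodF := fun p => a p + b p.
Definition prodF_one : prodF := fun=> 1.
Definition prodF_mul a b : prodF := fun p => a p * b p.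

Lemma prodF_addA : associative prodF_add.
Proof. by move=> a b c; apply: functional_extensionality_dep => p; apply: addrA. Qed.
Lemma prodF_addC : commutative prodF_add.
Proof. by move=> a b; apply: functional_extensionality_dep => p; apply: addrC. Qed.
Lemma prodF_add0 : left_id prodF_zero prodF_add.
Proof. by move=> a; apply: functional_extensionality_dep => p; apply: add0r. Qed.
Lemma prodF_addN : left_inverse prodF_zero prodF_opp prodF_add.
Proof. by move=> a; apply: functional_extensionality_dep => p; apply: addNr. Qed.
HB.instance Definition _ := GRing.isZmodule.Build prodF
  prodF_addA prodF_addC prodF_add0 prodF_addN.

Lemma prodF_mulA : associative prodF_mul.
Proof. by move=> a b c; apply: functional_extensionality_dep => p; apply: mulrA. Qed.
Lemma prodF_mulC : commutative prodF_mul.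
Proof. by move=> a b; apply: functional_extensionality_dep => p; apply: mulrC. Qed.
Lemma prodF_mul1 : left_id prodF_one prodF_mul.
Proof. by move=> a; apply: functional_extensionality_dep => p; apply: mul1r. Qed.
Lemma prodF_mulDl : left_distributive prodF_mul +%R.
Proof. by move=> a b c; apply: functional_extensionality_dep => p; apply: mulrDl. Qed.
Lemma prodF_one_neq0 : prodF_one != 0.
Proof.
apply/eqP => /(congr1 (fun a : prodF => a (exist _ 2%N isT))).
by move/eqP; rewrite (oner_eq0 'F_2).
Qed.
HB.instance Definition _ := GRing.Zmodule_isComNzRing.Build prodF
  prodF_mulA prodF_mulC prodF_mul1 prodF_mulDl prodF_one_neq0.

End ProductRing.

(* The direct sum of the 'F_p, as the ideal of finitely supported families. *)
Definition sumF : {pred prodF} :=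
  fun a => `[< finite_set [set p : primeT | a p != 0]%classic >].

Lemma sumFP (a : prodF) :
  reflect (finite_set [set p : primeT | a p != 0]%classic) (a \in sumF).
Proof. exact: asboolP. Qed.

Lemma finite_primeT_le (N : nat) :
  finite_set [set p : primeT | (val p <= N)%N]%classic.
Proof.
have -> : [set p : primeT | (val p <= N)%N]%classic =
    (val @^-1` [set n | (n < N.+1)%N])%classic by [].
apply: finite_preimage; last exact: finite_II.
by move=> p q _ _; apply: val_inj.
Qed.

Lemma sumF_ge (N : nat) (a : prodF) :
  (forall p : primeT, (N < val p)%N -> a p = 0) -> a \in sumF.
Proof.
move=> aN; apply/sumFP; apply: sub_finite_set (finite_primeT_le N) => p /=.
by apply: contraNT; rewrite -ltnNge => /aN/eqP.
Qed.

Lemma sumF_idealr_closed : idealr_closed sumF.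
Proof.
split.
- by apply: (@sumF_ge 0%N).
- apply/negP => /sumFP/finite_seqP[s sE].
  have [q q_gt q_pr] := prime_above (\max_(p <- s) val p).
  have : [set` s]%classic (exist _ q q_pr : primeT).
    by rewrite -sE /=; apply: (@oner_neq0 'F_q).
  move=> /= qs; move: q_gt; rewrite ltnNge => /negP; apply.
  exact: (@leq_bigmax_seq _ s predT val _ qs).
- move=> c a b /sumFP fa /sumFP fb; apply/sumFP.
  have fab : finite_set ([set p : primeT | a p != 0%R] `|`
                         [set p | b p != 0%R])%classic by rewrite finite_setU.
  apply: sub_finite_set fab => p /= cab0.
  have [a0|] := eqVneq (a p) 0; last by left.
  right; apply: contraNneq cab0 => b0.
  by change (c p * a p + b p == 0); rewrite a0 b0 mulr0 addr0.
Qed.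

HB.instance Definition _ := isIdealr.Build prodF sumF sumF_idealr_closed.

Definition scrA : Type := {ideal_quot sumF}.

HB.instance Definition _ := GRing.ComNzRing.on scrA.

Definition to_scrA (a : prodF) : scrA := \pi_{ideal_quot sumF} a.

Lemma to_scrA_is_zmod_morphism : zmod_morphism to_scrA.
Proof. exact: (raddfB \pi_{ideal_quot sumF}). Qed.
Lemma to_scrA_is_monoid_morphism : monoid_morphism to_scrA.
Proof.
by split; [apply: (rmorph1 \pi_{ideal_quot sumF})
         | apply: (rmorphM \pi_{ideal_quot sumF})].
Qed.
HB.instance Definition _ :=
  GRing.isZmodMorphism.Build prodF scrA to_scrA to_scrA_is_zmod_morphism.
HB.instance Definition _ :=
  GRing.isMonoidMorphism.Build prodF scrA to_scrA to_scrA_is_monoid_morphism.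

Lemma to_scrA_eq (a b : prodF) : (to_scrA a = to_scrA b) <-> (a - b \in sumF).
Proof. by rewrite Quotient.idealrBE; split=> [/eqP|/eqP]. Qed.

Lemma to_scrA_surj (x : scrA) : exists a, x = to_scrA a.
Proof. by exists (repr x); rewrite /to_scrA reprK. Qed.

Lemma to_scrA_eq_ge (N : nat) (a b : prodF) :
  (forall p : primeT, (N < val p)%N -> a p = b p) -> to_scrA a = to_scrA b.
Proof.
move=> ab; apply/to_scrA_eq/(@sumF_ge N) => p /ab abp.
by change (a p - b p = 0); rewrite abp subrr.
Qed.

Lemma intF_neq0 (d : int) (p : primeT) :
  d != 0 -> (`|d| < val p)%N -> d%:~R != 0 :> 'F_(val p).
Proof.
case: p => p p_pr /= d0 dp.
have h n : (n%:~R == 0 :> 'F_p) = (p %| `|n|)%N.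
  rewrite (dvdn_pcharf (pchar_Fp p_pr)).
  by case: n => n //; rewrite NegzE mulrNz oppr_eq0 abszN.
by rewrite h gtnNdvd // absz_gt0.
Qed.

Lemma ratr_fracE (F : fieldType) (x : rat) (n d : int) :
    (denq x)%:~R != 0 :> F -> d%:~R != 0 :> F -> x * d%:~R = n%:~R ->
  ratr x = n%:~R / d%:~R :> F.
Proof.
move=> xF dF xd; rewrite /ratr; apply/eqP; rewrite eqr_div // -!intrM eq_sym.
apply/eqP; congr _%:~R; apply: (@intr_inj rat); rewrite !intrM -xd numqE.
by rewrite -!mulrA [d%:~R * _]mulrC.
Qed.

(* The convention 0^-1 = 0 in 'F_p is harmless here: it only affects the
   finitely many primes dividing the denominator of q. *)
Definition rat_scrA (q : rat) : scrA := to_scrA (fun p => ratr q).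

Lemma rat_scrAD : {morph rat_scrA : x y / x + y}.
Proof.
move=> x y; rewrite /rat_scrA -rmorphD /=.
apply: (@to_scrA_eq_ge (`|denq x| + `|denq y| + `|denq (x + y)|)%N) => p.
move=> lt_p; change (ratr (x + y) = ratr x + ratr y :> 'F_(val p)).
have dx : (denq x)%:~R != 0 :> 'F_(val p).
  by apply: intF_neq0 => //; apply: leq_ltn_trans lt_p; rewrite -addnA leq_addr.
have dy : (denq y)%:~R != 0 :> 'F_(val p).
  by apply: intF_neq0 => //; apply: leq_ltn_trans lt_p; rewrite addnAC leq_addl.
have dxy : (denq (x + y))%:~R != 0 :> 'F_(val p).
  by apply: intF_neq0 => //; apply: leq_ltn_trans lt_p; rewrite leq_addl.
rewrite (@ratr_fracE _ _ (numq x * denq y + numq y * denq x)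
                         (denq x * denq y)) //.
- by rewrite intrD !intrM /ratr addf_div.
- by rewrite intrM mulf_neq0.
- by rewrite intrD !intrM !numqE mulrDl mulrA; congr (_ + _); rewrite mulrCA mulrC mulrAC.
Qed.

Lemma rat_scrAM : {morph rat_scrA : x y / x * y}.
Proof.
move=> x y; rewrite /rat_scrA -rmorphM /=.
apply: (@to_scrA_eq_ge (`|denq x| + `|denq y| + `|denq (x * y)|)%N) => p.
move=> lt_p; change (ratr (x * y) = ratr x * ratr y :> 'F_(val p)).
have dx : (denq x)%:~R != 0 :> 'F_(val p).
  by apply: intF_neq0 => //; apply: leq_ltn_trans lt_p; rewrite -addnA leq_addr.
have dy : (denq y)%:~R != 0 :> 'F_(val p).
  by apply: intF_neq0 => //; apply: leq_ltn_trans lt_p; rewrite addnAC leq_addl.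
have dxy : (denq (x * y))%:~R != 0 :> 'F_(val p).
  by apply: intF_neq0 => //; apply: leq_ltn_trans lt_p; rewrite leq_addl.
rewrite (@ratr_fracE _ _ (numq x * numq y) (denq x * denq y)) //.
- by rewrite !intrM /ratr mulf_div.
- by rewrite intrM mulf_neq0.
- by rewrite !intrM !numqE mulrACA.
Qed.

Lemma rat_scrA1 : rat_scrA 1 = 1.
Proof.
rewrite /rat_scrA -[RHS](rmorph1 to_scrA); apply: (@to_scrA_eq_ge 0%N) => p _.
by rewrite /ratr (_ : numq 1 = 1) // (_ : denq 1 = 1) // divr1.
Qed.

Definition scrA_scale (q : rat) (x : scrA) : scrA := rat_scrA q * x.

Lemma scrA_scaleA a b v : scrA_scale a (scrA_scale b v) = scrA_scale (a * b) v.
Proof. by rewrite /scrA_scale rat_scrAM mulrA. Qed.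
Lemma scrA_scale1 : left_id 1 scrA_scale.
Proof. by move=> v; rewrite /scrA_scale rat_scrA1 mul1r. Qed.
Lemma scrA_scaleDr : right_distributive scrA_scale +%R.
Proof. by move=> a u v; apply: mulrDr. Qed.
Lemma scrA_scaleDl v : {morph scrA_scale^~ v : a b / a + b}.
Proof. by move=> a b; rewrite /scrA_scale rat_scrAD mulrDl. Qed.
HB.instance Definition _ := GRing.Zmodule_isLmodule.Build rat scrA
  scrA_scaleA scrA_scale1 scrA_scaleDr scrA_scaleDl.

Lemma scrA_scaleAl (a : rat) (u v : scrA) : a *: (u * v) = (a *: u) * v.
Proof. exact: mulrA. Qed.
HB.instance Definition _ := GRing.Lmodule_isLalgebra.Build rat scrA scrA_scaleAl.
HB.instance Definition _ := GRing.Lalgebra_isComAlgebra.Build rat scrA.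

Definition int_scrA (a : primeT -> int) : scrA := to_scrA (fun p => (a p)%:~R).

Definition algebraic (F : fieldType) (A : algType F) (alpha : A) : Prop :=
  exists2 g : {poly F}, g != 0 & horner_alg alpha g = 0.

Definition transcendental (F : fieldType) (A : algType F) (alpha : A) : Prop :=
  ~ algebraic alpha.

Definition max_odd_divisor (n : nat) : nat :=
  (\max_(d <- divisors n | odd d) d)%N.

Lemma max_odd_divisorE n : (0 < n)%N -> max_odd_divisor n = (n`_2^')%N.
Proof.
move=> n0; apply/eqP; rewrite eqn_leq; apply/andP; split.
  apply/bigmax_leqP_seq => d; rewrite -dvdn_divisors // => dn od.
  apply: dvdn_leq; first exact: part_gt0.
  by rewrite -(@part_pnat_id (2^')%N d) ?partn_dvd // -odd_2'nat.
apply: (@leq_bigmax_seq _ _ (fun d => odd d) id).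
  by rewrite -dvdn_divisors // dvdn_part.
by rewrite odd_2'nat part_pnat.
Qed.

Definition k_ (p : nat) : nat := max_odd_divisor p.-1.

Lemma divn_k_ p : prime p -> (p.-1 %/ k_ p)%N = (p.-1`_2)%N.
Proof.
move=> pp; have p0 : (0 < p.-1)%N by case: p pp => [|[|]].
by rewrite /k_ max_odd_divisorE // -{1}(partnC 2%N p0) mulnK // part_gt0.
Qed.

(* Main.v *)
Require Import Defs.
From mathcomp Require Import all_boot all_order all_algebra.
From HB Require Import structures.
From mathcomp Require Import boolp classical_sets cardinality.
From mathcomp Require Import finfield ring zify.

Set Implicit Arguments.
Unset Strict Implicit.
Unset Printing Implicit Defensive.

Import GRing.Theory.

(** For every [m >= 2] there are infinitely many primes [p] such that [2 ^ m]
    is the exact power of [2] dividing [p - 1].  Indeed, let [x = 3 %[mod 8]] be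
    divisible by all small odd primes, and let [x ^ 2 ^ (m - 1) + 1 = 2 M].
    The prime divisors of [M] are large and congruent to [1] modulo [2 ^ m],
    since [x] has order [2 ^ m] modulo them; but [M = 1 + 2 ^ m] modulo
    [2 ^ (m + 1)], so they are not all congruent to [1] modulo [2 ^ (m + 1)].
    Consequently, if an integer polynomial [q] kills the given element, then
    [q.[f (2 ^ m)]] is divisible by infinitely many primes, hence is [0], for
    all [m >= 2]; as [f] is injective, [q] has infinitely many roots. *)

(** Residues equal to 1 are stable under products, so one prime factor is split off at a time. The
    contrapositive later yields a prime divisor not congruent to 1. *)
Lemma eqn1_mod_prime_divisors d n : 0 < n ->
  (forall p, prime p -> p %| n -> p = 1 %[mod d]) -> n = 1 %[mod d].
Proof.
elim/ltn_ind: n => n IH n_gt0 n_div.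
have [n_le1 | n_gt1] := leqP n 1; first by congr (_ %% _); lia.
have p_pr := pdiv_prime n_gt1.
have /dvdnP[k nE] := pdiv_dvd n.
have p_gt1 := prime_gt1 p_pr.
have k_gt0 : 0 < k by rewrite lt0n; apply: contraTneq n_gt0 => k0; rewrite nE k0.
have k1 : k = 1 %[mod d].
  apply: IH => // [|q q_pr q_dvd]; first by rewrite [ltnRHS]nE ltn_Pmulr.
  by apply: n_div => //; rewrite nE dvdn_mulr.
by rewrite nE -modnMm k1 (n_div _ p_pr (pdiv_dvd n)) modnMm.
Qed.

(** Squaring [1 + 2 ^ n.+3 * c] doubles the power of 2 and changes the cofactor [c] by an even
    amount. *)
Lemma expn_pow2_eq1_odd x n : x = 3 %[mod 8] ->
  exists2 c, odd c & x ^ 2 ^ n.+1 = (2 ^ n.+3 * c).+1.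
Proof.
move=> x3; elim: n => [|n [c c_odd cE]].
  rewrite (divn_eq x 8) x3 modn_small //; set k := x %/ 8.
  exists (8 * k ^ 2 + 6 * k + 1); first by lia.
  by rewrite expn1 -addn1; ring.
exists (c + 2 ^ n.+2 * c ^ 2); first by rewrite expnS; lia.
by rewrite expnS mulnC expnM cE -[in RHS]addn1 !(expnS 2); ring.
Qed.

(** Otherwise [p.-1] divides [2 ^ n * k] with [k] its odd part; then [x ^ (2 ^ n * k)] is 1 by
    Fermat but also [(-1) ^ k = -1] modulo [p]. *)
Lemma prime_dvd_pow2_add1 p x n : prime p -> odd p ->
  p %| (x ^ 2 ^ n).+1 -> 2 ^ n.+1 %| p.-1.
Proof.
move=> p_pr p_odd p_dvd; have p_gt1 := prime_gt1 p_pr.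
have p1_gt0 : 0 < p.-1 by lia.
rewrite pfactor_dvdn // ltnNge; apply/negP => le_vn.
pose k := p.-1`_2^'; have k_odd : odd k by rewrite odd_2'nat part_pnat.
have x_pow : (x%:R ^+ (2 ^ n)%N = -1 :> 'F_p)%R.
  apply/eqP; rewrite -subr_eq0 opprK -natrX natr1.
  by rewrite -(dvdn_pcharf (pchar_Fp p_pr)).
have x_neq0 : (x%:R != 0 :> 'F_p)%R.
  apply/eqP => x0; move: x_pow; rewrite x0 expr0n expn_eq0 /=.
  by move/eqP; rewrite eq_sym oppr_eq0 oner_eq0.
have x_fermat : (x%:R ^+ p.-1 = 1 :> 'F_p)%R.
  apply: (mulfI x_neq0); rewrite -exprS mulr1 prednK ?prime_gt0 //.
  by rewrite -[RHS]expf_card card_Fp.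
have /dvdnP[c cE] : p.-1 %| 2 ^ n * k.
  by rewrite -{1}(partnC 2 p1_gt0) p_part dvdn_mul ?dvdn_exp2l.
have : (x%:R ^+ (2 ^ n * k)%N = 1 :> 'F_p)%R.
  by rewrite cE mulnC exprM x_fermat expr1n.
rewrite exprM x_pow -signr_odd k_odd expr1 => /eqP.
rewrite eq_sym -subr_eq0 opprK -(natrD _ 1 1) -(dvdn_pcharf (pchar_Fp p_pr)).
by rewrite dvdn_prime2 // => /eqP p2; rewrite p2 in p_odd.
Qed.

Lemma infinite_prime_part2 n N :
  exists p, [/\ prime p, N < p & p.-1`_2 = 2 ^ n.+2].
Proof.
(* [Q] is a multiple of every odd prime up to [N]; being odd, it has square 1 modulo 8, whence the
   factor 3. *)
pose Q := N`!`_2^'; pose x := 3 * Q ^ 2.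
have Q_odd : odd Q by rewrite odd_2'nat part_pnat.
have x3 : x = 3 %[mod 8].
  have -> : x = 3 * ((Q %/ 2) * (Q %/ 2).+1 * 4 + 1).
    by rewrite /x {1}(divn_eq Q 2) modn2 Q_odd -[nat_of_bool true]/1; ring.
  have /dvdnP[c ->] : 2 %| (Q %/ 2) * (Q %/ 2).+1.
    by rewrite dvdn2 oddM oddS; case: odd.
  by rewrite (_ : _ * _ = 3 * c * 8 + 3) ?modnMDl //; ring.
have [c c_odd xE] := expn_pow2_eq1_odd n x3.
pose M := (2 ^ n.+2 * c).+1.
have xM : (x ^ 2 ^ n.+1).+1 = M * 2 by rewrite xE /M (expnS 2 n.+2); lia.
have M_odd : odd M by rewrite /M expnS; lia.
have M_neq1 : M <> 1 %[mod 2 ^ n.+3].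
  move=> /eqP; rewrite -[M]add1n -[in X in _ == X](addn0 1) eqn_modDl mod0n.
  rewrite (expnS 2 n.+2) (mulnC 2) -/(_ %| _) dvdn_pmul2l ?expn_gt0 // dvdn2.
  by rewrite c_odd.
have [p [p_pr p_dvd p_neq1]] :
    exists p, [/\ prime p, p %| M & p <> 1 %[mod 2 ^ n.+3]].
  apply: contra_notP M_neq1 => nex; apply: eqn1_mod_prime_divisors => // p pp pM.
  by apply: contra_notP nex => p1; exists p.
have p_gt1 := prime_gt1 p_pr; have p1_gt0 : 0 < p.-1 by lia.
have p_odd : odd p := dvdn_odd p_dvd M_odd.
have p_dvdx : p %| (x ^ 2 ^ n.+1).+1 by rewrite xM dvdn_mulr.
exists p; split=> //.
  (* An odd prime [p <= N] divides [Q], hence [x], and would then divide 1. *)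
  rewrite ltnNge; apply/negP => le_pN.
  have pQ : p %| Q.
    rewrite -(@part_pnat_id (2^')%N p) -?odd_2'nat // partn_dvd ?fact_gt0 //.
    by rewrite dvdn_fact // le_pN prime_gt0.
  have px : p %| x ^ 2 ^ n.+1 by rewrite dvdn_exp ?expn_gt0 ?dvdn_mull ?dvdn_exp.
  by move: p_dvdx; rewrite -addn1 dvdn_addr // dvdn1 => /eqP p1; rewrite p1 in p_pr.
have := prime_dvd_pow2_add1 p_pr p_odd p_dvdx.
rewrite p_part pfactor_dvdn // => le_v; congr (2 ^ _); apply/eqP.
rewrite eqn_leq le_v andbT leqNgt; apply/negP; rewrite -pfactor_dvdn // => p1.
apply: p_neq1; rewrite -(prednK (prime_gt0 p_pr)) -addn1.
by case/dvdnP: p1 => d ->; rewrite modnMDl.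
Qed.

Local Open Scope ring_scope.

(** Naming the evaluation at [p] lets it be declared a ring morphism, so that it commutes with
    [horner]. *)
Definition prodF_proj (p : primeT) (a : prodF) : 'F_(val p) := a p.

Lemma prodF_proj_is_zmod_morphism p : zmod_morphism (prodF_proj p).
Proof. by []. Qed.
Lemma prodF_proj_is_monoid_morphism p : monoid_morphism (prodF_proj p).
Proof. by []. Qed.
HB.instance Definition _ p := GRing.isZmodMorphism.Build prodF 'F_(val p)
  (prodF_proj p) (prodF_proj_is_zmod_morphism p).
HB.instance Definition _ p := GRing.isMonoidMorphism.Build prodF 'F_(val p)
  (prodF_proj p) (prodF_proj_is_monoid_morphism p).

Lemma sumF_bound (a : prodF) : a \in sumF ->
  exists N, forall p : primeT, (N < val p)%N -> a p = 0.
Proof.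
move=> /sumFP/finite_seqP[s sE]; exists (\max_(p <- s) val p)%N => p p_gt.
apply/eqP; apply: contraTT p_gt => ap_neq0; rewrite -leqNgt.
have ps : [set` s]%classic p by rewrite -sE.
exact: (@leq_bigmax_seq _ s predT val _ ps).
Qed.

Lemma algebraic_int_poly (A : algType rat) (alpha : A) : algebraic alpha ->
  exists2 q : {poly int}, q != 0 & (map_poly intr q).[alpha] = 0.
Proof.
case=> g g_neq0 g_alpha; have [q [a a_neq0 gE]] := rat_poly_scale g.
exists q; first by apply: contraNneq g_neq0 => q0; rewrite gE q0 rmorph0 scaler0.
have := g_alpha; rewrite gE linearZ /= => /(congr1 ( *:%R a%:~R)).
rewrite mulr_algl scalerA divff ?intr_eq0 // scale1r scaler0 => <-.
rewrite /horner_alg /horner_morph -map_poly_comp; congr _.[_].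
by apply: eq_map_poly => z /=; rewrite scaler_int.
Qed.

(** The value of [q] is computed on a lift in [prodF], where it lies in [sumF], and then projected
    to each component. *)
Lemma root_int_scrA (q : {poly int}) (a : primeT -> int) :
  (map_poly intr q).[int_scrA a] = 0 ->
  exists N, forall p : primeT, (N < val p)%N -> (q.[a p])%:~R = 0 :> 'F_(val p).
Proof.
pose b : prodF := fun p => (a p)%:~R.
have -> : map_poly intr q = map_poly to_scrA (map_poly intr q).
  by rewrite -map_poly_comp; apply: eq_map_poly => z /=; rewrite rmorph_int.
rewrite (_ : int_scrA a = to_scrA b) // horner_map /= -(rmorph0 to_scrA).
move=> /to_scrA_eq; rewrite subr0 => /sumF_bound[N qN]; exists N => p /qN.
rewrite -/(prodF_proj p _) -horner_map /= -map_poly_comp => <-.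
rewrite -horner_map; congr _.[_].
by apply: eq_map_poly => z /=; rewrite rmorph_int.
Qed.

Theorem theorem1p7 (f : nat -> int) (f_inj : injective f) :
  transcendental (int_scrA (fun p : primeT => f ((val p).-1 %/ k_ (val p))%N)).
Proof.
move=> /algebraic_int_poly[q q_neq0 /root_int_scrA[N qN]].
have q_root n : root q (f (2 ^ n.+2)%N).
  (* Exceeding [N] forces the value of [q] to vanish modulo [p]; exceeding its absolute value
     forbids this unless it is 0. *)
  have [p [p_pr]] := infinite_prime_part2 n (N + `|q.[f (2 ^ n.+2)%N]|).
  move=> p_gt p2; apply: contraT => q_neq; pose P : primeT := exist _ p p_pr.
  have P_gt : (N < val P)%N by rewrite /=; lia.
  have /eqP[] : (q.[f (2 ^ n.+2)%N])%:~R != 0 :> 'F_(val P).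
    by apply: intF_neq0 => //=; lia.
  by have := qN P P_gt; rewrite divn_k_ // p2.
(* These [size q] distinct roots are one more than the degree allows. *)
pose s := [seq f (2 ^ n.+2)%N | n <- iota 0 (size q)].
have := @max_poly_roots _ q s q_neq0.
rewrite size_map size_iota ltnn => /(_ _ _)/negP; apply=> //.
  by apply/allP => _ /mapP[n _ ->].
rewrite map_inj_uniq ?iota_uniq // => m n /f_inj /eqP.
by rewrite eqn_exp2l // => /eqP[].
Qed.
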